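(* For every integer $m\geq 1$, the Minkowski dimensions of $H_m$ and $G_m$ exist and $$\dim_{\rm M} H_m=\dim_{\rm M} G_m=1.$$
   Context: Let $\mathbb{Z}[i]=\{a+bi:a,b\in\mathbb{Z}\}$ and $Q=\{z\in\mathbb{C}:-\tfrac12\leq\operatorname{Re}z<\tfrac12,\ -\tfrac12\leq\operatorname{Im}z<\tfrac12\}$. For $w\in\mathbb{C}$ let $[w]\in\mathbb{Z}[i]$ be the unique Gaussian integer with $w-[w]\in Q$. The Hurwitz map $\mathcal{T}:Q\to Q$ is given by $\mathcal{T}(0)=0$ and $\mathcal{T}(z)=\frac1z-[\frac1z]$ for $z\in Q\setminus\{0\}$. For $z\in Q\setminus\{0\}$ put $z_0=z$ and, as long as $z_{j-1}\neq 0$, $z_j=\mathcal{T}(z_{j-1})$. For $m\ge 1$, $z$ is said to have a Hurwitz continued fraction expansion of length $m$ if $z_m=0$ and $z_j\neq0$ for $0\leq j\leq m-1$. Let $H_m$ ($m\ge1$) be the set of all $z\in Q$ having a Hurwitz continued fraction expansion of length $m$ (exactly). Define recursively $G_0=\{0\}$ and, for $m\geq1$, $G_m=\{\frac{1}{u+v}: u\in\mathbb{Z}[i],\ v\in G_{m-1},\ |u+v|>1\}$. For a non-empty bounded set $\Omega\subset\mathbb{R}^n$ and $r>0$, $\mathcal{N}_r(\Omega)$ is the smallest number of closed balls of radius $r$ required to cover $\Omega$. The lower and upper Minkowski dimensions are $\underline{\dim}_{\rm M}\Omega=\liminf_{r\to0^+}\frac{\log\mathcal{N}_r(\Omega)}{-\log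 r}$ and $\overline{\dim}_{\rm M}\Omega=\limsup_{r\to0^+}\frac{\log\mathcal{N}_r(\Omega)}{-\log r}$; if they agree, the common value is denoted $\dim_{\rm M}\Omega$. Here $\mathbb{C}$ is identified with $\mathbb{R}^2$. *)

(* Defs.v *)
From mathcomp Require Import all_boot all_order all_algebra.
From mathcomp Require Import complex lra.
From mathcomp Require Import all_classical all_reals all_analysis.

Set Implicit Arguments.
Unset Strict Implicit.
Unset Printing Implicit Defensive.

Import Order.TTheory GRing.Theory Num.Theory numFieldNormedType.Exports.

Local Open Scope classical_set_scope.
Local Open Scope ring_scope.
Local Open Scope complex_scope.

Section Hurwitz.
Variable R : realType.

Definition gaussian_integer : set R[i] :=
  [set w | exists a b : int, w = a%:~R +i* b%:~R].

Definition unit_square : set R[i] :=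
  [set z | - 2^-1 <= complex.Re z < 2^-1 /\ - 2^-1 <= complex.Im z < 2^-1].

Definition nearest_gaussian (w : R[i]) : R[i] :=
  xget 0 [set u | gaussian_integer u /\ unit_square (w - u)].

(* The default value 0 in nearest_gaussian is never used. *)
Lemma nearest_gaussianP (w : R[i]) :
  unique (fun u => gaussian_integer u /\ unit_square (w - u))
    (nearest_gaussian w).
Proof.
pose P := [set u | gaussian_integer u /\ unit_square (w - u)].
have sq (x : R) (a : int) :
    (- 2^-1 <= x - a%:~R < 2^-1) = (Num.floor (x + 2^-1) == a).
  by rewrite floor_eq intrD; apply/idP/idP => /andP[? ?]; apply/andP; split; lra.
suff [u [Pu uniu]] : exists u, unique P u.
  have := xgetI 0 Pu; rewrite -/(nearest_gaussian w) => Pn.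
  by split=> // u' Pu'; rewrite -(uniu _ Pn); exact: uniu.
case: w @P => x y P.
exists ((Num.floor (x + 2^-1))%:~R +i* (Num.floor (y + 2^-1))%:~R).
split; first by split; [by do 2 eexists | rewrite /unit_square/= !sq !eqxx].
by move=> _ [[a [b ->]]]; rewrite /unit_square/= !sq => -[/eqP -> /eqP ->].
Qed.

(* A map on all of R[i]; the Hurwitz map is its restriction to unit_square,
   which it maps into itself. *)
Definition hurwitz_map (z : R[i]) : R[i] :=
  if z == 0 then 0 else z^-1 - nearest_gaussian z^-1.

(* As hurwitz_map fixes 0, iterating past the first zero is harmless. *)
Definition hurwitz_orbit (z : R[i]) (j : nat) : R[i] := iter j hurwitz_map z.

Definition hurwitz_length (m : nat) : set R[i] :=
  [set z | [/\ unit_square z, z != 0, hurwitz_orbit z m = 0 &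
    forall j, (j < m)%N -> hurwitz_orbit z j != 0]].

Fixpoint gaussian_fractions (m : nat) : set R[i] :=
  if m is m'.+1 then
    [set z | exists u v, [/\ gaussian_integer u, gaussian_fractions m' v,
      1 < `|u + v| & z = (u + v)^-1]]
  else [set 0].

Definition closed_disc (c : R[i]) (r : R) : set R[i] :=
  [set z | `|z - c| <= r%:C].

Definition covered_by_discs (Omega : set R[i]) (r : R) (n : nat) : Prop :=
  exists c : 'I_n -> R[i], Omega `<=` \bigcup_i closed_disc (c i) r.

(* The default value 0 is taken only if no finite cover exists, which is the
   case of unbounded sets. Unbounded sets and the empty set get dimensions 0. *)
Definition covering_number (r : R) (Omega : set R[i]) : nat :=
  xget 0%N [set n | covered_by_discs Omega r n /\
    forall k, covered_by_discs Omega r k -> (n <= k)%N].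

Definition minkowski_ratio (Omega : set R[i]) (r : R) : \bar R :=
  (ln (covering_number r Omega)%:R / - ln r)%:E.

Definition lower_minkowski_dim (Omega : set R[i]) : \bar R :=
  limf_einf (minkowski_ratio Omega) 0^'+.

Definition upper_minkowski_dim (Omega : set R[i]) : \bar R :=
  limf_esup (minkowski_ratio Omega) 0^'+.

Definition has_minkowski_dim (Omega : set R[i]) (d : R) : Prop :=
  lower_minkowski_dim Omega = d%:E /\ upper_minkowski_dim Omega = d%:E.

End Hurwitz.

(* Main.v *)
(* Upper bound: by induction on m, G_m is covered by C (n + 1)^m 4^n discs of
   radius 4^-n. If |u| ~ 2^j then v |-> 1 / (u + v) contracts by 4^-j, so a cover
   of G_m at scale 4^(j - n) yields one of the corresponding piece of G_(m+1) at
   scale 4^-n; there are about 4^j such u, so each of the shells j <= n costs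
   about (n + 1)^m 4^n discs. All remaining points lie within 2^-n of the
   origin, a region covered by O(4^n) discs.
   Lower bound: H_m is contained in G_m. Fixing w of depth m - 1, the points
   1 / (u + w) with u in a box of side 2^n at distance ~ 2^n from the origin
   belong to H_m and are 4^-n-separated up to a constant, so 4^n discs are
   needed at scale 4^-n. *)
Require Import Defs.
From mathcomp Require Import all_boot all_order all_algebra.
From mathcomp Require Import all_classical all_reals all_analysis.
From mathcomp Require Import complex ring lra zify.
Import Order.TTheory GRing.Theory Num.Theory numFieldNormedType.Exports.

Set Implicit Arguments.
Unset Strict Implicit.
Unset Printing Implicit Defensive.

Local Open Scope ring_scope.

Section MinkowskiDimensionOne.
Local Open Scope classical_set_scope.
Local Open Scope complex_scope.
Variable R : realType.
Implicit Types (A B : set R[i]) (u v w z : R[i]) (r s : R) (k l m n : nat).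

(** * The modulus as a real-valued function *)

Local Notation normc := (@Normc.normc R).

Lemma normcEC z : `|z| = (normc z)%:C.
Proof. by []. Qed.

Lemma normc_ge0 z : 0 <= normc z.
Proof. by rewrite -lecR -normcEC normr_ge0. Qed.

Lemma normcM z w : normc (z * w) = normc z * normc w.
Proof. exact: Normc.normcM. Qed.

Lemma normcV z : normc z^-1 = (normc z)^-1.
Proof. exact: Normc.normcV. Qed.

Lemma ler_normcD z w : normc (z + w) <= normc z + normc w.
Proof. by rewrite -lecR rmorphD/= -!normcEC ler_normD. Qed.

Lemma normcB z w : normc (z - w) = normc (w - z).
Proof. by apply: complexI; rewrite /= -!normcEC distrC. Qed.

Lemma normcN z : normc (- z) = normc z.
Proof. by rewrite -sub0r normcB subr0. Qed.

Lemma ler_normc_dist w z z' : normc (z - z') <= normc (z - w) + normc (z' - w).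
Proof.
by rewrite [X in _ <= _ + X]normcB (le_trans _ (ler_normcD _ _))// subrKA.
Qed.

Lemma ler_Re_normc z : `|complex.Re z| <= normc z.
Proof. by rewrite -lecR -normcEC normc_ge_Re. Qed.

Lemma ler_Im_normc z : `|complex.Im z| <= normc z.
Proof.
case: z => a b /=; rewrite -[leLHS]sqrtr_sqr ler_wsqrtr//.
by rewrite lerDr sqr_ge0.
Qed.

Lemma ler_normc_ReIm z : normc z <= `|complex.Re z| + `|complex.Im z|.
Proof.
case: z => a b /=; rewrite -[leRHS]ger0_norm ?addr_ge0// -sqrtr_sqr.
rewrite ler_wsqrtr// sqrrD !real_normK ?num_real//.
by rewrite lerD2r lerDl mulrn_wge0// mulr_ge0.
Qed.

(** * Covers by discs and their behaviour under inversion *)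

Lemma closed_discE c r z : closed_disc c r z <-> normc (z - c) <= r.
Proof. by rewrite /closed_disc/= normcEC lecR. Qed.

Lemma normc_invB w w' : w != 0 -> w' != 0 ->
  normc (w^-1 - w'^-1) = normc (w - w') / (normc w * normc w').
Proof.
move=> w0 w'0; rewrite -normcM -normcV -normcM normcB; congr normc.
by field; rewrite w0 w'0.
Qed.

Lemma normc_neq0 w s : 0 < s -> s <= normc w -> w != 0.
Proof.
move=> s0 sw; apply/eqP => w0; move: sw; rewrite w0 Normc.normc0; lra.
Qed.

(** Inversion is Lipschitz with constant [s ^- 2] where the modulus is at least [s]; with [s] of
    order [2 ^ j] this is the contraction by [4 ^- j]. *)
Lemma normc_invB_le w w' s : 0 < s -> s <= normc w -> s <= normc w' ->
  normc (w^-1 - w'^-1) <= normc (w - w') / s ^+ 2.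
Proof.
move=> s0 sw sw'; rewrite normc_invB ?(normc_neq0 s0)//.
by rewrite ler_wpM2l ?normc_ge0// lef_pV2 ?posrE ?mulr_gt0 ?expr2 ?ler_pM//;
  lra.
Qed.

Lemma covered_subset A B r k : A `<=` B ->
  covered_by_discs B r k -> covered_by_discs A r k.
Proof. by move=> AB [c Bc]; exists c; apply: subset_trans Bc. Qed.

Lemma covered_radius A r s k : r <= s ->
  covered_by_discs A r k -> covered_by_discs A s k.
Proof.
move=> rs [c Ac]; exists c => z /Ac[i _ /closed_discE zi].
by exists i => //; apply/closed_discE; exact: le_trans rs.
Qed.

(** With any finite type as index of the discs, sums and products of index types do the counting for
    unions. *)
Lemma covered_fin A r (I : finType) (c : I -> R[i]) :
  (forall z, A z -> exists i, closed_disc (c i) r z) ->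
  covered_by_discs A r #|I|.
Proof.
move=> Ac; exists (c \o enum_val) => z /Ac[i zi].
by exists (enum_rank i) => //=; rewrite enum_rankK.
Qed.

Lemma covered_leq A r k l : (k <= l)%N ->
  covered_by_discs A r k -> covered_by_discs A r l.
Proof.
(* Indices beyond [k] get discs centred at 0. *)
move=> kl [c Ac]; exists (fun i => oapp c 0 (insub (val i))) => z /Ac[i _ zi].
by exists (widen_ord kl i) => //=; rewrite valK.
Qed.

Lemma covered_setU A B r k l : covered_by_discs A r k ->
  covered_by_discs B r l -> covered_by_discs (A `|` B) r (k + l).
Proof.
move=> [c Ac] [d Bd].
have -> : (k + l = #|{: 'I_k + 'I_l}|)%N by rewrite card_sum !card_ord.
apply: (@covered_fin _ _ _
  (fun i => match i with inl i => c i | inr j => d j end)).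
by move=> z [/Ac|/Bd] [i _ zi]; [exists (inl i)|exists (inr i)].
Qed.

Lemma covered_bigcup (I : finType) (A : I -> set R[i]) r k :
  (forall i, covered_by_discs (A i) r k) ->
  covered_by_discs (\bigcup_i A i) r (#|I| * k).
Proof.
move=> /choice[c Ac].
have -> : (#|I| * k = #|{: I * 'I_k}|)%N by rewrite card_prod card_ord.
apply: (@covered_fin _ _ _ (fun ij => c ij.1 ij.2)) => z [i _ /Ac[j _ zj]].
by exists (i, j).
Qed.

(* The factor 2 pays for moving the centres into A, where r bounds |u + v|. *)
Lemma covered_inv A u r s k : 0 < r -> covered_by_discs A s k ->
  covered_by_discs [set (u + v)^-1 | v in A `&` [set v | r <= normc (u + v)]]
    (2 * s / r ^+ 2) k.
Proof.
move=> r0 [c Ac].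
pose P i := [set v | [/\ A v, r <= normc (u + v) & closed_disc (c i) s v]].
exists (fun i => (u + xget 0 (P i))^-1) => _ [v [Av ruv] <-].
have [i _ vi] := Ac _ Av; exists i => //; apply/closed_discE.
have [_ rux xi] : P i (xget 0 (P i)) by apply: xgetPex; exists v.
rewrite (le_trans (normc_invB_le r0 ruv rux))// ler_wpM2r//.
  by rewrite invr_ge0 exprn_ge0// ltW.
move: vi xi => /closed_discE vi /closed_discE xi.
have := ler_normc_dist (c i) v (xget 0 (P i)).
rewrite (_ : u + v - _ = v - xget 0 (P i)); last first.
  by rewrite opprD addrACA subrr add0r.
lra.
Qed.

(** Two points in one disc of radius [r] are at most [2 * r] apart, so sending each point to a disc
    that contains it is injective. *)
Lemma leq_covered A r k (I : finType) (f : I -> R[i]) :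
  (forall i, A (f i)) ->
  (forall i j, i != j -> 2 * r < normc (f i - f j)) ->
  covered_by_discs A r k -> (#|I| <= k)%N.
Proof.
move=> Af sepf [c Ac].
have /choice[g gP] i : exists j : 'I_k, normc (f i - c j) <= r.
  by have [j _ /closed_discE] := Ac _ (Af i); exists j.
rewrite -[leqRHS]card_ord; apply: (@leq_card _ _ g) => i j gij.
apply/eqP/negP => /negP /sepf; rewrite ltNge => /negP; apply.
rewrite (le_trans (ler_normc_dist (c (g i)) _ _))//.
by have := gP i; have := gP j; rewrite -gij; lra.
Qed.

(** * Gaussian integers in boxes and shells *)

(** The box [[-k, k]^2], shifted so that a finite type of known cardinality indexes it. *)
Definition gaussian_box_elt k (p : 'I_(k + k).+1 * 'I_(k + k).+1) : R[i] :=
  (p.1%:R - k%:R) +i* (p.2%:R - k%:R).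

Lemma int_box k (a : int) : `|a| <= k%:Z ->
  exists p : 'I_(k + k).+1, a%:~R = p%:R - k%:R :> R.
Proof.
move=> ak; have lt_p : (absz (a + k%:Z)%R < (k + k).+1)%N by lia.
exists (Ordinal lt_p) => /=; rewrite !pmulrn -intrB; congr (_ %:~R); lia.
Qed.

(** An integer outside [[-k, k]] has absolute value at least [k + 1]. The gain of 1 later absorbs a
    tail [v] with [|v| <= 1]. *)
Lemma gaussian_box u k : gaussian_integer u ->
  (exists p, u = @gaussian_box_elt k p) \/ k.+1%:R <= normc u.
Proof.
move=> [a [b ->]].
have norm_ge (c : int) : ~ (`|c| <= k%:Z) -> k.+1%:R <= `|c%:~R| :> R.
  move=> ck; rewrite -intr_norm pmulrn ler_int; lia.
have [/int_box[p ->]|/negP/norm_ge ka] := boolP (`|a| <= k%:Z); last first.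
  by right; rewrite (le_trans ka)// (ler_Re_normc (a%:~R +i* b%:~R)).
have [/int_box[q ->]|/negP/norm_ge kb] := boolP (`|b| <= k%:Z); last first.
  by right; rewrite (le_trans kb)// (ler_Im_normc (_ +i* b%:~R)).
by left; exists (p, q).
Qed.

(** On a grid of mesh [r / 2], rounding down costs at most [r / 2] per coordinate, hence at most [r]
    in modulus; [4 * k + 1] grid values span [[- r * k, r * k]]. *)
Lemma covered_square r k : 0 < r ->
  covered_by_discs [set z | normc z <= r * k%:R] r ((4 * k + 1) ^ 2).
Proof.
move=> r0; have -> : ((4 * k + 1) ^ 2 =
    #|{: 'I_(2 * k + 2 * k).+1 * 'I_(2 * k + 2 * k).+1}|)%N.
  by rewrite card_prod card_ord; lia.
apply: (@covered_fin _ _ _ (fun p => (r / 2)%:C * gaussian_box_elt p)) => z zk.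
have coord (x : R) : `|x| <= r * k%:R -> exists p : 'I_(2 * k + 2 * k).+1,
    `|x - r / 2 * (p%:R - (2 * k)%N%:R)| <= r / 2.
  (* [y] is the distance from the left end [- r * k] to [x], in units of the mesh. *)
  rewrite ler_norml => /andP[kx xk]; pose y := (x + r * k%:R) / (r / 2).
  have y0 : 0 <= y by rewrite divr_ge0 ?divr_ge0//; lra.
  have yk : y <= (2 * k + 2 * k)%N%:R.
    by rewrite ler_pdivrMr ?divr_gt0// natrD natrM; lra.
  have /andP[ty yt] := truncn_itv y0.
  have tk : (Num.truncn y < (2 * k + 2 * k).+1)%N.
    by rewrite ltnS -(ler_nat R) (le_trans ty).
  exists (Ordinal tk) => /=.
  have -> : x = r / 2 * (y - (2 * k)%N%:R).
    by rewrite /y natrM; field; rewrite gt_eqF.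
  have r2 : 0 <= r / 2 by lra.
  rewrite -mulrBr normrM ger0_norm// ler_piMr//.
  by rewrite ler_norml; move: yt; rewrite -natr1; lra.
have [[p xp] [q yq]] := (coord _ (le_trans (ler_Re_normc z) zk),
                         coord _ (le_trans (ler_Im_normc z) zk)).
exists (p, q); apply/closed_discE; rewrite (le_trans (ler_normc_ReIm _))//.
case: z {zk} xp yq => x y /=.
rewrite !mul0r !subr0 !addr0; lra.
Qed.

(** For [j > 0] the lower bound holds because [u] misses the box of half-side [2 ^ (j - 1)]. For
    [j = 0] it is replaced later by [1 < |u + v|]. *)
Lemma gaussian_shell u n : gaussian_integer u ->
  (exists2 j, (j <= n)%N & (exists p, u = @gaussian_box_elt (2 ^ j) p) /\
     (j = 0%N \/ 2 ^+ j / 2 + 1 <= normc u)) \/ 2 ^+ n + 1 <= normc u.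
Proof.
move=> gu; elim: n => [|n [[j jn jP]|IH]].
- have [p|/=] := gaussian_box 1 gu; last by right; rewrite expr0; lra.
  by left; exists 0%N => //; split; [|left].
- by left; exists j => //; rewrite leqW.
- have [p|] := gaussian_box (2 ^ n.+1) gu.
    by left; exists n.+1 => //; split => //; right; rewrite exprSr mulfK.
  by rewrite -natr1 natrX; right.
Qed.

(** * Upper bound: covers of [G_m] *)

Lemma gaussian_fractions_le1 m z : gaussian_fractions m z -> normc z <= 1.
Proof.
case: m => [->|m [u [v [_ _ uv1 ->]]]]; first by rewrite Normc.normc0.
move: uv1; rewrite normcEC -[1]/(1%:C) ltcR => uv1.
by rewrite normcV invf_le1 ?ltW// (lt_trans _ uv1).
Qed.

(** The box has at most [9 * 4 ^ j] elements and [4 ^ (n + 2 - j)] is [16 * 4 ^ (n - j)], whence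
    144; the power [3 ^ m] comes from [n - j + 3 <= 3 * (n + 1)]. *)
Lemma shell_count (C m j n : nat) : (j <= n)%N ->
  ((2 ^ j + 2 ^ j).+1 ^ 2 * (C * (n + 2 - j).+1 ^ m * 4 ^ (n + 2 - j)) <=
   144 * C * 3 ^ m * n.+1 ^ m * 4 ^ n)%N.
Proof.
move=> jn.
have -> : (n + 2 - j = (n - j).+2)%N by lia.
have lm : ((n - j).+3 ^ m <= 3 ^ m * n.+1 ^ m)%N.
  rewrite -expnMn; case: m => // m; rewrite leq_exp2r//; lia.
have [e4 p2] : (4 ^ n = 2 ^ j * 2 ^ j * 4 ^ (n - j))%N /\ (0 < 2 ^ j)%N.
  by rewrite -expnMn -expnD subnKC ?expn_gt0.
have -> : (144 * C * 3 ^ m * n.+1 ^ m * 4 ^ n =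
    9 * (2 ^ j * 2 ^ j) * (C * (3 ^ m * n.+1 ^ m) * (16 * 4 ^ (n - j))))%N.
  by rewrite e4; ring.
rewrite leq_mul//; first by nia.
have -> : (4 ^ (n - j).+2 = 16 * 4 ^ (n - j))%N by rewrite !expnS; ring.
by rewrite !leq_mul.
Qed.

(** The [n + 1] shells raise the exponent of [n.+1] by one; the core costs at most
    [(5 * 2 ^ n) ^ 2], whence 25. *)
Lemma shell_sum (C m n : nat) :
  (n.+1 * (144 * C * 3 ^ m * n.+1 ^ m * 4 ^ n) + (4 * 2 ^ n + 1) ^ 2 <=
   (144 * C * 3 ^ m + 25) * n.+1 ^ m.+1 * 4 ^ n)%N.
Proof.
rewrite (expnS n.+1); have -> : (4 ^ n = 2 ^ n * 2 ^ n)%N by rewrite -expnMn.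
have p2 : (0 < 2 ^ n)%N by rewrite expn_gt0.
have pm : (0 < n.+1 * n.+1 ^ m)%N by rewrite muln_gt0 expn_gt0.
rewrite mulnDl mulnDl; apply: leq_add; first by apply: eq_leq; ring.
apply: (@leq_trans (25 * (2 ^ n * 2 ^ n))); first by nia.
by apply: leq_mul => //; apply: leq_pmulr.
Qed.

(** The two extra levels of precision gain a factor 16, against a loss of 2 from recentring and 4
    from [(2 ^+ j / 2) ^+ 2]. *)
Lemma shell_radius j n : (j <= n)%N ->
  2 * 4 ^- (n + 2 - j) / (2 ^+ j / 2) ^+ 2 <= 4 ^- n :> R.
Proof.
move=> jn.
have -> : (n + 2 - j = (n - j).+2)%N by lia.
have -> : 4 ^+ n = (2 ^+ j) ^+ 2 * 4 ^+ (n - j) :> R.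
  rewrite -exprM mulnC exprM (_ : 2 ^+ 2 = 4); last by ring.
  by rewrite -exprD subnKC.
rewrite !exprS.
have : (0:R) < 2 ^+ j by rewrite exprn_gt0.
have : (0:R) < 4 ^+ (n - j) by rewrite exprn_gt0.
move: (2 ^+ j) (4 ^+ (n - j)) => x y y0 x0.
rewrite (_ : _ / _ = (x ^+ 2 * y)^-1 / 2); last by field; rewrite !gt_eqF.
have : 0 <= (x ^+ 2 * y)^-1 by rewrite invr_ge0 mulr_ge0 ?sqr_ge0 ?ltW.
lra.
Qed.

Lemma covered_gaussian_fractions m : exists C, forall n,
  covered_by_discs (@gaussian_fractions R m) (4 ^- n) (C * n.+1 ^ m * 4 ^ n).
Proof.
elim: m => [|m [C IH]].
  exists 1%N => n; apply: (@covered_leq _ _ #|{: 'I_1}|).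
    by rewrite card_ord mul1n expn0 mul1n expn_gt0.
  apply: (@covered_fin _ _ _ (fun=> 0)) => z ->; exists ord0.
  by apply/closed_discE; rewrite subrr Normc.normc0 invr_ge0 exprn_ge0.
exists (144 * C * 3 ^ m + 25)%N => n.
pose shell (j : 'I_n.+1) := \bigcup_p [set (@gaussian_box_elt (2 ^ j) p + v)^-1 |
  v in gaussian_fractions m `&`
       [set v | 2 ^+ j / 2 <= normc (gaussian_box_elt p + v)]].
(* The radius is [2 ^- n], written as a multiple of [4 ^- n] to fit [covered_square]. *)
pose core := [set z | normc z <= 4 ^- n * (2 ^ n)%N%:R].
have cover_core : covered_by_discs core (4 ^- n) ((4 * 2 ^ n + 1) ^ 2).
  by apply: covered_square; rewrite invr_gt0 exprn_gt0.
have cover_shell j : covered_by_discs (shell j) (4 ^- n)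
    (144 * C * 3 ^ m * n.+1 ^ m * 4 ^ n).
  have jn : (j <= n)%N by rewrite -ltnS.
  apply: covered_leq (shell_count _ _ jn) _.
  have -> : ((2 ^ j + 2 ^ j).+1 ^ 2 =
      #|{: 'I_(2 ^ j + 2 ^ j).+1 * 'I_(2 ^ j + 2 ^ j).+1}|)%N.
    by rewrite card_prod card_ord.
  apply: covered_bigcup => p; apply: covered_radius; last first.
    by apply: covered_inv (IH (n + 2 - j)%N); rewrite divr_gt0 ?exprn_gt0.
  exact: shell_radius.
apply: covered_leq (covered_subset _
  (covered_setU (covered_bigcup cover_shell) cover_core)).
  by rewrite card_ord shell_sum.
move=> _ [u [v [gu Gv uv1 ->]]]; move: uv1.
rewrite normcEC -[1]/(1%:C) ltcR => uv1.
have v1 := gaussian_fractions_le1 Gv.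
have uv : normc u <= normc (u + v) + normc v.
  by have := ler_normcD (u + v) (- v); rewrite addrK normcN.
(* As [|v| <= 1], the bounds on [|u|] become [2 ^+ j / 2 <= |u + v|] in a shell and
   [2 ^+ n <= |u + v|] beyond all of them. *)
have [[j jn [[p up] jP]]|nu] := gaussian_shell n gu.
  left; exists (Ordinal (jn : (j < n.+1)%N)) => //; exists p => //.
  rewrite -up; exists v => //; split => //=.
  by case: jP => [->|]; rewrite ?expr0; lra.
right; rewrite /core/= normcV natrX -[4]/(2 * 2)%:R.
rewrite natrM exprMn invfM -mulrA mulVf ?expf_neq0// mulr1.
by rewrite lef_pV2 ?posrE ?exprn_gt0//; lra.
Qed.

(** * Lower bound: Hurwitz orbits and separated points of [H_m] *)

Lemma nearest_gaussian_eq w u : gaussian_integer u -> unit_square (w - u) ->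
  nearest_gaussian w = u.
Proof. by move=> gu wu; apply: (nearest_gaussianP w).2. Qed.

Lemma unit_square_normc_lt1 z : unit_square z -> normc z < 1.
Proof.
case: z => x y [/= /andP[x1 x2] /andP[y1 y2]].
rewrite -sqrtr1 ltr_sqrt// !expr2; nra.
Qed.

Lemma normc_unit_square z : normc z < 2^-1 -> unit_square z.
Proof.
move=> z2; have := le_lt_trans (ler_Re_normc z) z2.
have := le_lt_trans (ler_Im_normc z) z2.
by rewrite !ltr_norml => /andP[? ?] /andP[? ?]; split; apply/andP; split; lra.
Qed.

(* Unlike hurwitz_length, this makes sense for m = 0, where it describes {0}. *)
Definition hurwitz_depth m z :=
  [/\ unit_square z, hurwitz_orbit z m = 0 &
    forall j, (j < m)%N -> hurwitz_orbit z j != 0].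

Lemma hurwitz_lengthS m z : hurwitz_length m.+1 z <-> hurwitz_depth m.+1 z.
Proof.
by split=> [[sz _ z0 zj]|[sz z0 zj]]; split => //; exact: (zj 0%N).
Qed.

(** As [w] lies in the unit square, [u] is the Gaussian integer nearest to [u + w], so the Hurwitz
    map sends [(u + w)^-1] back to [w]. The bound 2 puts [(u + w)^-1] in the disc of radius 1/2,
    inside the square. *)
Lemma hurwitz_depth_inv m u w : gaussian_integer u -> hurwitz_depth m w ->
  2 < normc (u + w) -> hurwitz_depth m.+1 (u + w)^-1.
Proof.
move=> gu [sw w0 wj] uw.
have uw0 : u + w != 0 by apply: (@normc_neq0 _ 2); rewrite ?ltW.
have Tz : hurwitz_map (u + w)^-1 = w.
  rewrite /hurwitz_map invr_eq0 (negbTE uw0) invrK (@nearest_gaussian_eq _ u)//.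
    by rewrite addrAC subrr add0r.
  by rewrite addrAC subrr add0r.
split.
- by apply: normc_unit_square; rewrite normcV ltf_pV2 ?posrE//; lra.
- by rewrite /hurwitz_orbit iterSr Tz.
- case=> [_|j]; first by rewrite invr_eq0.
  by rewrite ltnS /hurwitz_orbit iterSr Tz => /wj.
Qed.

Lemma hurwitz_depth_exists m : exists z, hurwitz_depth m z.
Proof.
elim: m => [|m [w dw]].
  exists 0; split => //; apply: normc_unit_square.
  by rewrite Normc.normc0 invr_gt0.
(* The digit 4 is large enough: [|w| < 1] gives [|4 + w| > 3]. *)
exists (4%:C + w)^-1; apply: hurwitz_depth_inv => //.
  by exists 4, 0; rewrite /= -!pmulrn.
have := ler_normc_dist (- w) 4%:C 0.
have [/unit_square_normc_lt1 w1 _ _] := dw.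
rewrite subr0 opprK add0r.
have : normc 4%:C = 4 by apply: complexI; rewrite -normcEC ger0_norm// ler0c.
lra.
Qed.

(** Take [u] nearest to [z^-1] and [v] the image of [z], which has depth one less; [u + v = z^-1]
    exceeds 1 in modulus because the square lies in the open unit disc. *)
Lemma hurwitz_depth_sub m z : hurwitz_depth m z -> gaussian_fractions m z.
Proof.
elim: m z => [z []//|m IH z [sz z0 zj]].
have nz0 : z != 0 := zj 0%N isT.
have [gu su] := (nearest_gaussianP z^-1).1.
have Tz : hurwitz_map z = z^-1 - nearest_gaussian z^-1.
  by rewrite /hurwitz_map (negbTE nz0).
exists (nearest_gaussian z^-1), (hurwitz_map z).
rewrite [X in 1 < `|X|](_ : _ = z^-1); last by rewrite Tz addrC subrK.
rewrite [X in z = X^-1](_ : _ = z^-1); last by rewrite Tz addrC subrK.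
split => //; last by rewrite invrK.
- apply: IH; split; first by rewrite Tz.
    by rewrite /hurwitz_orbit -iterSr.
  by move=> j jm; rewrite /hurwitz_orbit -iterSr; apply: (zj j.+1).
- rewrite normcEC -[1]/(1%:C) ltcR normcV invf_gt1 ?unit_square_normc_lt1//.
  by rewrite lt_def normc_ge0 andbT; apply: contra nz0 => /eqP/Normc.eq0_normc->.
Qed.

Lemma hurwitz_packing m n k :
  covered_by_discs (@hurwitz_length R m.+1) (4 ^- (n + 4)) k -> (4 ^ n <= k)%N.
Proof.
have [w dw] := hurwitz_depth_exists m.
(* The offset [4 * 2 ^ n] forces [|u + w| > 2], while [|u| <= 10 * 2 ^ n] and [|w| < 1] give
   [|u + w| <= 11 * 2 ^ n]. *)
pose b (p : 'I_(2 ^ n)) : R := (4 * 2 ^ n + p)%N%:R.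
pose u (p : 'I_(2 ^ n) * 'I_(2 ^ n)) : R[i] := b p.1 +i* b p.2.
have [sw _ _] := dw; have w1 := unit_square_normc_lt1 sw.
have X1 : 1 <= 2 ^+ n :> R by rewrite exprn_ege1// ler1n.
have bE p : 4 * 2 ^+ n <= b p <= 5 * 2 ^+ n.
  rewrite /b natrD natrM natrX lerDl ler0n/=.
  have : p%:R <= (2 ^ n)%:R :> R by rewrite ler_nat ltnW.
  by rewrite natrX; lra.
have uw p : 2 < normc (u p + w) <= 11 * 2 ^+ n.
  have /andP[b1 b1'] := bE p.1; have /andP[b2 b2'] := bE p.2.
  have u4 : 4 * 2 ^+ n <= normc (u p).
    by rewrite (le_trans _ (ler_Re_normc _))// ger0_norm//=; lra.
  have u10 : normc (u p) <= 10 * 2 ^+ n.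
    by rewrite (le_trans (ler_normc_ReIm _))// !ger0_norm//=; lra.
  have := ler_normcD (u p) w; have := ler_normcD (u p + w) (- w).
  by rewrite addrK normcN; lra.
have sep p q : p != q -> 1 <= normc (u p - u q).
  have bsep (i j : 'I_(2 ^ n)) : i != j -> 1 <= `|b i - b j|.
    move=> ij; rewrite /b !pmulrn -intrB -intr_norm -[1]/(1%:~R) ler_int.
    by move: ij; rewrite -val_eqE/=; lia.
  case: p q => [p1 p2] [q1 q2]; rewrite xpair_eqE negb_and.
  move=> /orP[/bsep pq|/bsep pq]; rewrite (le_trans pq)//.
    exact: (ler_Re_normc (u (p1, p2) - u (q1, q2))).
  exact: (ler_Im_normc (u (p1, p2) - u (q1, q2))).
have -> : (4 ^ n = #|{: 'I_(2 ^ n) * 'I_(2 ^ n)}|)%N.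
  by rewrite card_prod card_ord -expnMn.
apply: (@leq_covered _ _ _ _ (fun p => (u p + w)^-1)) => [p|p q pq].
  apply/hurwitz_lengthS/hurwitz_depth_inv => //; last by have /andP[] := uw p.
  by exists (4 * 2 ^ n + p.1)%N%:Z, (4 * 2 ^ n + p.2)%N%:Z; rewrite -!pmulrn.
have /andP[p2 pn] := uw p; have /andP[q2 qn] := uw q.
rewrite normc_invB; try by apply: (@normc_neq0 _ 2); rewrite ?ltW.
rewrite (_ : u p + w - (u q + w) = u p - u q); last first.
  by rewrite opprD addrACA subrr addr0.
have pq1 := sep _ _ pq.
rewrite ltr_pdivlMr ?mulr_gt0//; try lra.
rewrite (lt_le_trans _ pq1)//.
(* The points are at least [4 ^- n / 121] apart, and the discs have diameter [4 ^- n / 128]; this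
   fixes the shift by 4. *)
have -> : 4 ^- (n + 4) = ((2 ^+ n) ^+ 2)^-1 / 256 :> R.
  by rewrite exprD -exprM mulnC exprM (_ : 2 ^+ 2 = 4); [field|ring].
set x := 2 ^+ n in X1 pn qn *.
have pqx : normc (u p + w) * normc (u q + w) <= 121 * x ^+ 2 by nra.
have x2 : 0 < x ^+ 2 by rewrite exprn_gt0//; lra.
have y0 : 0 <= (x ^+ 2)^-1 by rewrite invr_ge0 ltW.
have := ler_wpM2l y0 pqx; rewrite [leRHS]mulrCA mulVf; last by rewrite gt_eqF.
move: (x ^+ 2)^-1 (normc _ * normc _) => y P; lra.
Qed.

(** * From covering counts to Minkowski dimensions *)

(** The set where [f] is within [e] of [l] belongs to [F], which bounds the limit superior above; it
    meets every member of the proper filter [F], which bounds it below. *)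
Lemma limf_esup_cvg (T : choiceType) (X : filteredType T) (F : set_system X)
    (f : X -> R) (l : R) : ProperFilter F ->
  f @ F --> l -> limf_esup (EFin \o f) F = l%:E.
Proof.
move=> FF /cvgrPdist_le fl; rewrite limf_esupE; apply/eqP.
rewrite eq_le; apply/andP; split.
- apply/lee_addgt0Pr => e e0; apply: ge_ereal_inf.
  exists (ereal_sup ((EFin \o f) @` [set x | `|l - f x| <= e])).
    by exists [set x | `|l - f x| <= e] => //; exact: fl.
  apply/ereal_supP => _ [x /= + <-]; rewrite -EFinD lee_fin ler_distl; lra.
- apply/ereal_infP => _ [V FV <-]; apply/lee_subgt0Pr => e e0.
  have [x [Vx /= lfx]] := filter_ex (filterI FV (fl e e0)).
  apply: le_ereal_sup_tmp; exists (f x)%:E; first by exists x.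
  by rewrite -EFinB lee_fin; move: lfx; rewrite ler_distl; lra.
Qed.

Lemma limf_einf_cvg (T : choiceType) (X : filteredType T) (F : set_system X)
    (f : X -> R) (l : R) : ProperFilter F ->
  f @ F --> l -> limf_einf (EFin \o f) F = l%:E.
Proof.
move=> FF fl; rewrite /limf_einf.
have -> : (fun x => - (EFin \o f) x)%E = EFin \o (fun x => - f x) by [].
by rewrite (@limf_esup_cvg _ _ _ _ (- l)) ?EFinN ?oppeK//; exact: cvgN.
Qed.

(** One finite cover suffices for a least one to exist, so the default value of [covering_number] is
    not taken. *)
Lemma covering_numberP A r k : covered_by_discs A r k ->
  covered_by_discs A r (covering_number r A) /\ (covering_number r A <= k)%N.
Proof.
move=> Ak; have exA : exists k, `[< covered_by_discs A r k >].
  by exists k; apply/asboolP.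
pose P := [set n | covered_by_discs A r n /\
  forall k, covered_by_discs A r k -> (n <= k)%N].
have [cA minA] : P (covering_number r A).
  apply: xgetPex; case: (ex_minnP exA) => n /asboolP An nmin.
  by exists n; split => // l Al; apply/nmin/asboolP.
by split => //; exact: minA.
Qed.

(** Both [ln N] and [- ln r] equal [n * ln 4] up to the stated error. The upper count is taken at
    the finer scale [n + 5], the lower one at [n + 4]. *)
Lemma ln_covering_number A (C m : nat) :
  (forall n, covered_by_discs A (4 ^- n) (C.+1 * n.+1 ^ m * 4 ^ n)) ->
  (forall n k, covered_by_discs A (4 ^- (n + 4)) k -> (4 ^ n <= k)%N) ->
  forall r n, 4 ^- (n + 5) < r <= 4 ^- (n + 4) ->
  `|ln (covering_number r A)%:R + ln r| <=
    ln C.+1%:R + m%:R * ln (n + 6)%:R + 5 * ln 4.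
Proof.
move=> ub lb r n /andP[nr rn].
have r0 : 0 < r by apply: lt_trans nr; rewrite invr_gt0 exprn_gt0.
have [Nr Nu] := covering_numberP (covered_radius (ltW nr) (ub (n + 5)%N)).
have Nl := lb _ _ (covered_radius rn Nr).
set N := covering_number r A in Nr Nu Nl *.
have N0 : (0 < N)%N by apply: leq_trans Nl; rewrite expn_gt0.
have l4 : 0 < ln 4 :> R by rewrite ln_gt0// ltr1n.
have lnu : ln N%:R <= ln C.+1%:R + m%:R * ln (n + 6)%:R + (n + 5)%:R * ln 4 :> R.
  rewrite (@le_trans _ _ (ln (C.+1 * (n + 5).+1 ^ m * 4 ^ (n + 5))%N%:R))//.
    rewrite ler_ln ?posrE ?ltr0n ?ler_nat//.
    by rewrite !muln_gt0 !expn_gt0.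
  rewrite !natrM !natrX !lnM ?lnXn ?posrE ?mulr_gt0 ?exprn_gt0 ?ltr0n//.
  by rewrite -addnS -[X in _ + X + _ <= _]mulr_natl -[X in _ + X <= _]mulr_natl.
have lnl : n%:R * ln 4 <= ln N%:R :> R.
  rewrite mulr_natl -lnXn// ler_ln ?posrE ?ltr0n ?exprn_gt0//.
  by rewrite -natrX ler_nat.
have lnr k : ln (4 ^- k) = - (k%:R * ln 4) :> R.
  by rewrite lnV ?posrE ?exprn_gt0// lnXn// mulr_natl.
have lr1 : - ((n + 5)%:R * ln 4) <= ln r.
  by rewrite -lnr ler_ln ?posrE ?ltW// invr_gt0 exprn_gt0.
have lr2 : ln r <= - ((n + 4)%:R * ln 4).
  by rewrite -lnr ler_ln ?posrE// invr_gt0 exprn_gt0.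
have C0 : 0 <= ln C.+1%:R :> R by rewrite ln_ge0// ler1n.
have n6 : 0 <= m%:R * ln (n + 6)%:R :> R.
  by rewrite mulr_ge0// ln_ge0// ler1n addnS.
by rewrite ler_norml; move: lnu lr1 lr2 n6; rewrite !natrD; lra.
Qed.

(** The ratio differs from 1 by [(ln N + ln r) / - ln r], whose numerator is only logarithmic in
    [n], hence in [- ln r]. *)
Lemma minkowski_dim1 A (C m : nat) :
  (forall n, covered_by_discs A (4 ^- n) (C.+1 * n.+1 ^ m * 4 ^ n)) ->
  (forall n k, covered_by_discs A (4 ^- (n + 4)) k -> (4 ^ n <= k)%N) ->
  has_minkowski_dim A 1.
Proof.
move=> ub lb; pose f r : R := ln (covering_number r A)%:R / - ln r.
suff fl : f r @[r --> 0^'+] --> (1 : R).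
  by split; [exact: limf_einf_cvg|exact: limf_esup_cvg].
have l4 : 0 < ln 4 :> R by rewrite ln_gt0// ltr1n.
apply/cvgrPdist_le => e e0.
(* With this d, ln (n + 6) <= d (n + 6) - ln d makes the m ln (n + 6) term of
   ln_covering_number at most e t / 2 plus a constant, for t = - ln r. *)
pose d := e * ln 4 / 2 / m.+1%:R.
have d0 : 0 < d by rewrite !mulr_gt0 ?invr_gt0.
pose c := ln C.+1%:R + 5 * ln 4 - m%:R * ln d + m%:R * d * 6.
have ln_lt (x : R) : \forall r \near (0 : R)^'+, ln r < x.
  near=> r; have r0 : 0 < r by near: r; exact: nbhs_right_gt.
  rewrite -[x]expRK ltr_ln ?posrE ?expR_gt0//.
  by near: r; apply: nbhs_right_lt; exact: expR_gt0.
near=> r.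
have lr4 : ln r < - (4 * ln 4) by near: r; exact: ln_lt.
(* [c] gathers the terms of the error bound independent of [r]; this makes them less than
   [e * t / 2]. *)
have lrc : ln r < - (2 * c / e) by near: r; exact: ln_lt.
have r0 : 0 < r by near: r; exact: nbhs_right_gt.
pose t := - ln r; have tE : ln r = - t by rewrite opprK.
have t0 : 0 < t by rewrite /t; lra.
have /andP[kt tk] := truncn_itv (divr_ge0 (ltW t0) (ltW l4)).
set k := Num.truncn (t / ln 4) in kt tk.
have k4 : (4 <= k)%N.
  by rewrite -ltnS -(ltr_nat R) (le_lt_trans _ tk)// ler_pdivlMr// /t; lra.
(* [k] is the level with [4 ^- (k + 1) < r <= 4 ^- k]; [k4] keeps this subtraction from
   truncating. *)
pose n := (k - 4)%N; have kn : k = (n + 4)%N by rewrite subnK.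
have lnr j : ln (4 ^- j) = - (j%:R * ln 4) :> R.
  by rewrite lnV ?posrE ?exprn_gt0// lnXn// mulr_natl.
have nr : 4 ^- (n + 5) < r <= 4 ^- (n + 4).
  apply/andP; split.
    rewrite -ltr_ln ?posrE ?invr_gt0 ?exprn_gt0// lnr tE ltrN2.
    by rewrite -ltr_pdivrMr// addnS -kn.
  rewrite -ler_ln ?posrE ?invr_gt0 ?exprn_gt0// lnr tE lerN2.
  by rewrite -ler_pdivlMr// -kn.
have := ln_covering_number ub lb nr.
have ln6 : ln (n + 6)%:R <= d * (n + 6)%:R - ln d.
  rewrite lerBrDr -lnM ?posrE ?ltr0n// 1?addnS// mulrC.
  by rewrite ltW// ln_sublinear// mulr_gt0// ltr0n.
have mn6 : m%:R * ln (n + 6)%:R <= m%:R * (d * (n + 6)%:R - ln d).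
  by rewrite ler_wpM2l.
have mdn : m%:R * d * n%:R <= e * t / 2.
  have -> : m%:R * d * n%:R = e / 2 * (n%:R * ln 4) * (m%:R / m.+1%:R).
    have : m.+1%:R != 0 :> R by rewrite pnatr_eq0.
    by rewrite /d; move: (m.+1%:R) => M M0; field.
  have nt : n%:R * ln 4 <= t.
    by rewrite -ler_pdivlMr// (le_trans _ kt)// ler_nat leq_subr.
  have m1 : m%:R / m.+1%:R <= 1 :> R.
    by rewrite ler_pdivrMr// mul1r ler_nat leqnSn.
  have nl : 0 <= n%:R * ln 4 :> R by rewrite mulr_ge0// ltW.
  have e2 : 0 <= e / 2 by rewrite divr_ge0 ?ltW.
  apply: (@le_trans _ _ (e / 2 * (n%:R * ln 4))).
    by rewrite ler_piMr// mulr_ge0.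
  by rewrite [leRHS]mulrAC ler_wpM2l.
have -> : 1 - f r = - ((ln (covering_number r A)%:R + ln r) / t).
  by rewrite /f tE opprK; field; rewrite gt_eqF.
rewrite normrN normrM normfV (gtr0_norm t0) ler_pdivrMr// => /le_trans; apply.
move: lrc; rewrite tE ltrN2 ltr_pdivrMr// /c => lrc.
move: mn6 mdn lrc; move: (ln (n + 6)%:R) => L; rewrite natrD; clear.
by move: (ln C.+1%:R) (ln 4) (ln d) => *; lra.
Unshelve. all: by end_near.
Qed.

End MinkowskiDimensionOne.

Theorem theorem1p1 (R : realType) (m : nat) (hm : (1 <= m)%N) :
  has_minkowski_dim (@hurwitz_length R m) 1 /\
  has_minkowski_dim (@gaussian_fractions R m) 1.
Proof.
case: m hm => // m _.
have [C ub] := covered_gaussian_fractions R m.+1.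
have lb := @hurwitz_packing R m.
(* The inclusion carries the upper bound down to [H_m] and the lower bound up to [G_m]. *)
have sub : (@hurwitz_length R m.+1 `<=` gaussian_fractions m.+1)%classic.
  by move=> z /hurwitz_lengthS; exact: hurwitz_depth_sub.
(* Passing to [C.+1] makes the constant positive, as needed for its logarithm. *)
have {}ub n : covered_by_discs (@gaussian_fractions R m.+1) (4 ^- n)
    (C.+1 * n.+1 ^ m.+1 * 4 ^ n).
  by apply: covered_leq (ub n); rewrite !leq_mul.
split; apply: (@minkowski_dim1 _ _ C m.+1) => // n.
  exact: covered_subset (ub n).
by move=> k /(covered_subset sub); exact: lb.
Qed.
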